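(* Let $\mathcal{H}$ be a separable Hilbert space, let $K\in B(\mathcal{H})$ be an operator with closed range $\mathcal{R}_K$, let $C,C'\in GL(\mathcal{H})$, and let $\mathcal{W}=\{W_i,w_i\}_{i\in I}$ be a $(C,C')$-controlled $K$-fusion frame for $\mathcal{H}$ with lower and upper bounds $A_{CC'}$ and $B_{CC'}$, respectively. Let $\{V_i\}_{i\in I}$ be a family of closed subspaces of $\mathcal{H}$. If there exists a number $0<R<A_{CC'}$ such that $$0<\sum_{i\in I} w_i^2\langle C'^*(\pi_{V_i}-\pi_{W_i})Cf,f\rangle\le R\|f\|^2\quad\text{for all nonzero } f\in\mathcal{H},$$ then $\mathcal{V}=\{V_i,w_i\}_{i\in I}$ is a $(C,C')$-controlled Bessel $K$-fusion sequence for $\mathcal{H}$ and a $(C,C')$-controlled $K$-fusion frame for $\mathcal{R}_K$.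
   Context: $I$ is a countable index set; $B(\mathcal{H})$ denotes the bounded linear operators on $\mathcal{H}$; $GL(\mathcal{H})$ is the set of bounded invertible operators on $\mathcal{H}$ with bounded inverse; $\pi_W$ is the orthogonal projection of $\mathcal{H}$ onto a closed subspace $W$; weights $w_i$ are positive real numbers. Given $K\in B(\mathcal{H})$, $C,C'\in GL(\mathcal{H})$, closed subspaces $W_i\subseteq\mathcal{H}$ and weights $w_i>0$, the family $\mathcal{W}=\{W_i,w_i\}_{i\in I}$ is a $(C,C')$-controlled $K$-fusion frame for $\mathcal{H}$ with bounds $A_{CC'},B_{CC'}$ if $0<A_{CC'}\le B_{CC'}<\infty$ and $$A_{CC'}\|K^*f\|^2\le\sum_{i\in I}w_i^2\langle\pi_{W_i}Cf,\pi_{W_i}C'f\rangle\le B_{CC'}\|f\|^2\quad\text{for all } f\in\mathcal{H}.$$ If only the right-hand inequality is required (for some finite constant), $\mathcal{W}$ is a $(C,C')$-controlled Bessel $K$-fusion sequence for $\mathcal{H}$. The family is a $(C,C')$-controlled $K$-fusion frame for $\mathcal{R}_K$ if, for some constants $0<A\le B<\infty$, the two inequalities hold for all $f\in\mathcal{R}_K$. *)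

(* Defs.v *)
From HB Require Import structures.
From mathcomp Require Import all_boot all_order all_algebra.
From mathcomp Require Import complex.
From mathcomp Require Import all_classical all_reals all_analysis.
From mathcomp.analysis.showcase Require Import summability.

Set Implicit Arguments.
Unset Strict Implicit.
Unset Printing Implicit Defensive.

Import Order.TTheory GRing.Theory Num.Theory.
Import numFieldNormedType.Exports.

Local Open Scope classical_set_scope.
Local Open Scope ring_scope.

Variant scalar_kind := RealScalars | ComplexScalars.

(* The order of R[i] is partial: x <= y means that y - x is a nonnegative real.
   Hence [0 < a] says that the scalar a is a positive real number, and an
   inequality between a sum and a real number says that the sum is real. *)
Definition scalars (R : realType) (k : scalar_kind) : numFieldType :=
  match k with
  | RealScalars => R
  | ComplexScalars => R[i]
  end.

Definition scalar_conj (R : realType) (k : scalar_kind) :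
    {rmorphism scalars R k -> scalars R k} :=
  match k with
  | RealScalars => idfun
  | ComplexScalars => @conjc R
  end.

(* [hdot] is linear in its first argument and conjugate-linear in the second. *)
Record hilbertSpace (R : realType) (k : scalar_kind) := HilbertSpace {
  hilbert_carrier :> completeNormedModType (scalars R k);
  hdot : {dot hilbert_carrier for scalar_conj R k};
  hdotE : forall x : hilbert_carrier, `|x| ^+ 2 = hdot x x
}.

Notation "''[' u , v ]" := (hdot _ u%R v%R) : ring_scope.

Definition separable_space (T : topologicalType) :=
  exists S : set T, countable S /\ dense S.

Section hilbert.
Context {R : realType} {k : scalar_kind} {H : hilbertSpace R k}.
Local Notation F := (scalars R k).

Definition bounded_operator (T : {linear H -> H}) :=
  exists M : F, forall x, `|T x| <= M * `|x|.

Definition boundedly_invertible (T : {linear H -> H}) :=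
  bounded_operator T /\
  exists S : {linear H -> H}, [/\ bounded_operator S, cancel T S & cancel S T].

Definition closed_subspace (W : set H) :=
  [/\ closed W, W 0 & forall (a : F) x y, W x -> W y -> W (a *: x + y)].

(* The default value 0 is never used when T is a bounded operator (Riesz
   representation), and the representative is then unique. *)
Definition adjoint (T : H -> H) (y : H) : H :=
  xget 0 [set z | forall x, '[T x, y] = '[x, z]].

(* The default value 0 is never used when W is a closed subspace, and the
   vector p is then unique. *)
Definition orth_proj (W : set H) (x : H) : H :=
  xget 0 [set p | W p /\ forall y, W y -> '[x - p, y] = 0].

(* I carries no order, so sums over I are unconditional: limits of the net of
   the partial sums over the finite subsets of I. *)
Definition summable_over (I : countType) (x : I -> F) :=
  cvg (partial_sum (x : I -> F^o) @ totally).

Definition sum_over (I : countType) (x : I -> F) : F := sum (x : I -> F^o).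

Section fusion.
Context {I : countType}.
Implicit Types (D : set H) (K C : {linear H -> H}) (W : I -> set H).
Implicit Types (w : I -> F) (A B : F).

Definition controlled_terms C (C' : {linear H -> H}) W w (f : H)
    (i : I) : F :=
  w i ^+ 2 * '[orth_proj (W i) (C f), orth_proj (W i) (C' f)].

Definition controlled_K_fusion_frame_on D K C (C' : {linear H -> H}) W w A B :=
  0 < A /\ A <= B /\
  forall f, D f ->
    [/\ summable_over (controlled_terms C C' W w f),
        A * `|adjoint K f| ^+ 2 <= sum_over (controlled_terms C C' W w f)
      & sum_over (controlled_terms C C' W w f) <= B * `|f| ^+ 2].

Definition controlled_bessel_K_fusion C (C' : {linear H -> H}) W w :=
  exists B : F, 0 < B /\ forall f,
    summable_over (controlled_terms C C' W w f) /\
    sum_over (controlled_terms C C' W w f) <= B * `|f| ^+ 2.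

End fusion.
End hilbert.

(* Main.v *)
(** Since [pi_V] is a self-adjoint idempotent,
    [<pi_V C f, pi_V C' f> = <C'^* pi_V C f, f>], so the controlled sum of the
    [V_i] is that of the [W_i] plus the perturbation sum, which lies in
    [[0, r |f|^2]]. Hence [A] remains a lower bound and [B + r] is an upper one,
    on all of [H]. The substance is that [pi_V] and [C'^*] are the intended
    operators, i.e. the projection theorem and the Riesz representation
    theorem, over real or complex scalars alike. The point nearest to [x] in a
    closed convex set is found as the common point of the sets of those points
    that are no farther from [x] than a given one; the parallelogram law makes
    the diameters of these sets small. *)

Require Import Defs.
From HB Require Import structures.
From mathcomp Require Import all_boot all_order all_algebra.
From mathcomp Require Import complex.
From mathcomp Require Import all_classical all_reals all_analysis.
From mathcomp.analysis.showcase Require Import summability.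

Set Implicit Arguments.
Unset Strict Implicit.
Unset Printing Implicit Defensive.

Import Order.TTheory GRing.Theory Num.Theory.
Import numFieldNormedType.Exports.
Local Open Scope classical_set_scope.
Local Open Scope ring_scope.

Lemma cantor_intersection (K : numFieldType) (T : completePseudoMetricType K)
    (I : Type) (D : set I) (S : I -> set T) :
  (forall i, D i -> S i !=set0) -> (forall i, D i -> closed (S i)) ->
  (forall i j, D i -> D j -> exists2 k, D k & S k `<=` S i `&` S j) ->
  (forall e, 0 < e ->
    exists2 i, D i & forall x y, S i x -> S i y -> ball x e y) ->
  \bigcap_(i in D) S i !=set0.
Proof.
move=> S_neq0 S_closed S_directed S_small.
have [i0 Di0 _] := S_small 1 ltr01.
have S_filter : Filter (filter_from D S).
  by apply: filter_from_filter S_directed; exists i0.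
have S_proper := filter_from_proper S_filter S_neq0.
have /cvg_ex[x Sx] : cvg (filter_from D S).
  apply: cauchy_cvg; apply/cauchy_ballP => e /S_small[i Di Si].
  by exists (S i, S i) => [|[y z] [/= Siy Siz]]; [split; exists i|exact: Si].
exists x => i Di; apply: (@closed_cvg _ _ _ S_proper id _ (S_closed i Di)) Sx.
by exists i.
Qed.

Section normed_modules.
Context {K : numFieldType}.

Lemma closed_norm_sub_le (V : normedModType K) (x : V) (r : K) :
  closed [set y | `|x - y| <= r].
Proof.
move=> y cl_y; apply/ler_addgt0Pr => e e0.
have [z [/= xz]] := cl_y _ (nbhsx_ballx y e e0).
rewrite -ball_normE/= distrC => /ltW zy.
by rewrite -(subrKA z) (le_trans (ler_normD _ _))// lerD.
Qed.

Lemma linear_norm_bounded_continuous (V W : normedModType K)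
    (f : {linear V -> W}) (M : K) :
  (forall x, `|f x| <= M * `|x|) -> continuous f.
Proof.
move=> fM; apply/bounded_linear_continuous/bounded_funP => r.
exists (`|M| * r) => x xr; apply: (le_trans (fM x)).
have Mx_ge0 : 0 <= M * `|x| := le_trans (normr_ge0 _) (fM x).
by rewrite -(ger0_norm Mx_ge0) normrM normr_id ler_wpM2l.
Qed.

Lemma convex_set_midpoint (M : lmodType K) (C : set (convex_lmodType M))
    (x y : M) :
  convex_set C -> C x -> C y -> C (2^-1 *: (x + y)).
Proof.
move=> Cconv Cx Cy.
have half_ge0 : 0 <= 2^-1 :> K by rewrite invr_ge0.
have half_le1 : 2^-1 <= 1 :> K by rewrite invf_le1 ?ler1n.
have /set_mem := Cconv x y (Itv01 half_ge0 half_le1) (mem_set Cx) (mem_set Cy).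
rewrite -[conv _ _ _]/(2^-1 *: x + (1 - 2^-1) *: y).
by rewrite [X in X - _]splitr div1r addrK -scalerDr.
Qed.

End normed_modules.

Lemma exists_approx_min (R : realType) (S : set R) (e : R) :
  has_inf S -> 0 < e -> exists2 s, S s & forall t, S t -> s < t + e.
Proof.
move=> infS e0; have [s Ss s_lt] := inf_adherent e0 infS.
exists s => // t St; apply: (lt_le_trans s_lt).
by rewrite lerD2r ge_inf//; case: infS.
Qed.

Section scalars.
Context {R : realType} {k : scalar_kind}.
Local Notation F := (scalars R k).

Lemma scalar_conjK : involutive (scalar_conj R k).
Proof. by case: k => // x; exact: conjcK. Qed.

(* The order of R[i] is not total, but the elements of a set with a lower bound
   all have the same imaginary part. *)
Lemma exists_approx_min_scalar (S : set F) (m e : F) :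
  S !=set0 -> lbound S m -> 0 < e ->
  exists2 s, S s & forall t, S t -> s < t + e.
Proof.
case: k S m e => /= S m e S0 mS.
  by apply: exists_approx_min; split=> //; exists m.
rewrite ltcE/= => /andP[/eqP Im_e Re_e].
have Im_S s : S s -> complex.Im s = complex.Im m.
  by move=> /mS; rewrite lecE => /andP[/eqP].
have infS : has_inf [set complex.Re s | s in S].
  split; first by case: S0 => s Ss; exists (complex.Re s), s.
  exists (complex.Re m) => _ [s /mS + <-].
  by rewrite lecE => /andP[].
have [_ [s Ss <-] s_min] := exists_approx_min infS Re_e.
exists s => // t St; rewrite ltcE !raddfD/= Im_e addr0 !Im_S// eqxx/=.
by apply: s_min; exists t.
Qed.

End scalars.

Section hilbert.
Context {R : realType} {k : scalar_kind} {H : hilbertSpace R k}.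
Local Notation F := (scalars R k).
Implicit Types (x y z : H) (C W : set H) (T : {linear H -> H}).

Lemma hdotC x y : '[x, y] = scalar_conj R k '[y, x].
Proof. by rewrite hermC expr0 mul1r. Qed.

Lemma parallelogram x y :
  `|x + y| ^+ 2 + `|x - y| ^+ 2 = `|x| ^+ 2 *+ 2 + `|y| ^+ 2 *+ 2.
Proof.
rewrite !hdotE hnormD hnormB.
by rewrite addrACA subrr addr0 -mulr2n mulrnDl.
Qed.

Lemma apollonius x y z :
  `|y - z| ^+ 2 = `|x - y| ^+ 2 *+ 2 + `|x - z| ^+ 2 *+ 2 -
    `|x - 2^-1 *: (y + z)| ^+ 2 *+ 4.
Proof.
have double_median : (x - z) + (x - y) = 2 *: (x - 2^-1 *: (y + z)).
  rewrite scalerBr scalerA divff ?pnatr_eq0// scale1r scaler_nat mulr2n.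
  by rewrite opprD addrACA [- z - y]addrC.
have := parallelogram (x - z) (x - y).
rewrite double_median normrZ normr_nat exprMn -natrX mulr_natl.
rewrite [x - z - _](_ : _ = y - z); last by rewrite opprB addrC subrKA.
by move=> law; rewrite [X in _ = X - _]addrC -law [RHS]addrC addKr.
Qed.

Lemma sqr_dist_near_minimizers C x (a e : F) y z :
  convex_set (C : set (convex_lmodType H)) ->
  (forall u, C u -> a < `|x - u| ^+ 2 + e) ->
  C y -> `|x - y| ^+ 2 <= a -> C z -> `|x - z| ^+ 2 <= a ->
  `|y - z| ^+ 2 < e *+ 4.
Proof.
move=> Cconv a_min Cy xy Cz xz.
have a_lt := a_min _ (convex_set_midpoint Cconv Cy Cz).
rewrite (apollonius x) ltrBlDr -!mulrnDl.
apply: (@le_lt_trans _ _ (a *+ 4)); last by rewrite ltrMn2r addrC.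
by rewrite (mulrnA a 2 2) ler_wMn2r// mulr2n lerD.
Qed.

Lemma exists_nearest_point C x :
  C !=set0 -> closed C -> convex_set (C : set (convex_lmodType H)) ->
  exists2 p, C p & forall y, C y -> `|x - p| <= `|x - y|.
Proof.
move=> C0 Cclosed Cconv; pose nearer z := C `&` [set y | `|x - y| <= `|x - z|].
suff [p nearer_p] : \bigcap_(z in C) nearer z !=set0.
  exists p; last by move=> y /nearer_p[].
  by case: C0 => z /nearer_p[].
apply: cantor_intersection => [z Cz|z Cz|z z' Cz Cz'|e e0].
- by exists z; split=> /=.
- by apply: closedI => //; exact: closed_norm_sub_le.
- have /orP[zz'|z'z] := ger_leVge (normr_ge0 (x - z)) (normr_ge0 (x - z')).
    by exists z => // y [Cy yz]; split; split=> //; exact: le_trans zz'.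
  by exists z' => // y [Cy yz]; split; split=> //; exact: le_trans z'z.
have [|||_ [z Cz <-] z_min] := @exists_approx_min_scalar _ _
    [set `|x - y| ^+ 2 | y in C] 0 ((e / 2) ^+ 2).
- by case: C0 => y Cy; exists (`|x - y| ^+ 2), y.
- by move=> _ [y _ <-]; exact: exprn_ge0.
- by rewrite exprn_gt0// divr_gt0.
exists z => // y y' [Cy xy] [Cy' xy']; rewrite -ball_normE/=.
rewrite -(@ltr_pXn2r _ 2)// ?nnegrE ?(ltW e0)//.
have -> : e ^+ 2 = (e / 2) ^+ 2 *+ 4.
  by rewrite -mulr_natr (natrX _ 2 2) -exprMn divfK ?pnatr_eq0.
apply: (sqr_dist_near_minimizers (a := `|x - z| ^+ 2)) Cconv _ Cy _ Cy' _.
- by move=> u Cu; apply: z_min; exists u.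
- by rewrite ler_pXn2r ?nnegrE.
- by rewrite ler_pXn2r ?nnegrE.
Qed.

Definition line_proj y x : H := ('[x, y] / '[y, y]) *: y.

Lemma sqr_norm_sub_line_proj x y : y != 0 ->
  `|x - line_proj y x| ^+ 2 = `|x| ^+ 2 - `|'[x, y]| ^+ 2 / `|y| ^+ 2.
Proof.
move=> y0; have ny0 : `|y| != 0 by rewrite normr_eq0.
have orth : '[x - line_proj y x, line_proj y x] = 0.
  rewrite linearZr_LR linearBl/= linearZl_LR/= divfK ?subrr ?mulr0//.
  by rewrite -hdotE expf_neq0.
have norm_line_proj : `|line_proj y x| = `|'[x, y]| / `|y|.
  rewrite normrZ normrM normfV -hdotE normrX normr_id expr2 invfM mulrA.
  by rewrite divfK.
have pythagoras : `|x| ^+ 2 = `|x - line_proj y x| ^+ 2 + `|line_proj y x| ^+ 2.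
  by rewrite -[x in LHS](subrK (line_proj y x)) !hdotE hnormDd.
by rewrite pythagoras -exprVn -exprMn -norm_line_proj addrK.
Qed.

Lemma hdot_cauchy_schwarz x y : `|'[x, y]| <= `|x| * `|y|.
Proof.
have [->|y0] := eqVneq y 0; first by rewrite linear0r !normr0 mulr0.
have := exprn_ge0 2 (normr_ge0 (x - line_proj y x)).
rewrite sqr_norm_sub_line_proj// subr_ge0 ler_pdivrMr ?exprn_gt0 ?normr_gt0//.
by rewrite -exprMn ler_pXn2r ?nnegrE ?mulr_ge0.
Qed.

Lemma closed_subspace_convex W :
  closed_subspace W -> convex_set (W : set (convex_lmodType H)).
Proof.
move=> [_ W0 Wlin] x y a /set_mem Wx /set_mem Wy.
by apply/mem_set/Wlin => //; rewrite -[_ *: y]addr0; exact: Wlin.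
Qed.

Lemma exists_orth_proj W x : closed_subspace W ->
  exists p, W p /\ forall y, W y -> '[x - p, y] = 0.
Proof.
move=> subW; have [Wclosed W0 Wlin] := subW.
have [||p Wp p_min] := exists_nearest_point x _ Wclosed.
- by exists 0.
- exact: closed_subspace_convex.
exists p; split=> // y Wy; have [->|y0] := eqVneq y 0; first exact: linear0r.
(* Moving p by the projection of x - p on y cannot bring it closer to x. *)
have := p_min _ (Wlin ('[x - p, y] / '[y, y]) _ _ Wy Wp).
rewrite [_ + p]addrC opprD addrA -[_ *: y]/(line_proj y _).
rewrite -(@ler_pXn2r _ 2)// ?nnegrE// sqr_norm_sub_line_proj//.
rewrite lerBrDl gerDr pmulr_lle0 ?invr_gt0 ?exprn_gt0 ?normr_gt0// => le0.
by apply/eqP; rewrite -normr_eq0 -sqrf_eq0 eq_le le0 exprn_ge0.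
Qed.

Lemma orth_projP W x : closed_subspace W ->
  W (orth_proj W x) /\ forall y, W y -> '[x - orth_proj W x, y] = 0.
Proof. by move=> subW; exact: (xgetPex 0 (exists_orth_proj x subW)). Qed.

Lemma hdot_orth_proj W x y : closed_subspace W ->
  '[orth_proj W x, orth_proj W y] = '[orth_proj W x, y].
Proof.
move=> subW; have [Wx _] := orth_projP x subW.
have [_ /(_ _ Wx) y_orth] := orth_projP y subW.
by apply/eqP; rewrite eq_sym -subr_eq0 -linearBr herm_eq0C; exact/eqP.
Qed.

Lemma closed_subspace_ker (V : normedModType F) (f : {linear H -> V}) :
  continuous f -> closed_subspace (f @^-1` [set 0]).
Proof.
move=> f_cont; split; last 2 first.
- exact: linear0.
- by move=> a x y /= fx0 fy0; rewrite linearP fx0 fy0 scaler0 addr0.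
apply: preimage_closed; first by move=> x _; exact: f_cont.
exact/accessible_closed_set1/hausdorff_accessible/norm_hausdorff.
Qed.

Lemma riesz_representation (phi : {linear H -> F^o}) :
  continuous phi -> exists z, forall x, phi x = '[x, z].
Proof.
move=> /closed_subspace_ker ker_sub.
have [phi0|] := pselect (forall x, phi x = 0).
  by exists 0 => x; rewrite phi0 linear0r.
move=> /existsNP[x0 /eqP phi_x0].
have [p [/= phi_p orth_u]] := exists_orth_proj x0 ker_sub.
set u := x0 - p in orth_u.
have phi_u : phi u != 0 by rewrite linearB phi_p subr0.
have uu : '[u, u] != 0.
  rewrite -hdotE expf_neq0// normr_eq0; apply: contra_neq phi_u => ->.
  exact: linear0.
exists (scalar_conj R k (phi u / '[u, u]) *: u) => x.
(* phi u *: x - phi x *: u lies in the kernel of phi, hence is orthogonal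
   to u. *)
have phi_ux : phi u * '[x, u] = phi x * '[u, u].
  apply/eqP; rewrite -subr_eq0 -!linearZl_LR -linearBl herm_eq0C.
  apply/eqP/orth_u; rewrite /= linearB !(linearZ_LR phi)/=.
  by rewrite -[phi x *: phi u]mulrC subrr.
by rewrite linearZr_LR/= scalar_conjK mulrAC phi_ux mulfK.
Qed.

Lemma hdot_adjointr T x y : bounded_operator T ->
  '[T x, y] = '[x, adjoint T y].
Proof.
move=> [M TM].
have hdotT_linear : linear (fun x => '[T x, y] : F^o).
  by move=> a u v; rewrite linearP linearDl/= linearZl_LR.
pose phi : {linear H -> F^o} := HB.pack (fun x => '[T x, y] : F^o)
  (GRing.isLinear.Build _ _ _ _ _ hdotT_linear).
have phi_cont : continuous phi.
  apply: (@linear_norm_bounded_continuous _ _ _ phi (M * `|y|)) => u.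
  by rewrite (le_trans (hdot_cauchy_schwarz _ _))// mulrAC ler_wpM2r.
exact: (xgetPex 0 (riesz_representation phi_cont)).
Qed.

Lemma hdot_adjointl T x y : bounded_operator T ->
  '[adjoint T x, y] = '[x, T y].
Proof. by move=> bT; rewrite hdotC -hdot_adjointr// -hdotC. Qed.

End hilbert.

Section unconditional_sums.
Context {R : realType} {k : scalar_kind} {I : countType}.
Local Notation F := (scalars R k).
Implicit Types (a b : I -> F) (s t : F).

#[local] Existing Instance totally_filter.

Definition has_sum a s :=
  partial_sum (a : I -> F^o) @ totally --> (s : F^o).

Lemma has_sum_summable_over a s : has_sum a s -> summable_over a.
Proof. by move=> a_s; apply/cvg_ex; exists s. Qed.

Lemma has_sum_sum_over a s : has_sum a s -> sum_over a = s.
Proof.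
by move=> a_s; apply: cvg_lim => //; exact: norm_hausdorff.
Qed.

Lemma has_sum0 : has_sum (fun=> 0) 0.
Proof.
rewrite /has_sum (_ : partial_sum _ = fun=> 0); first exact: cvg_cst.
by apply/funext => J; rewrite /partial_sum big1.
Qed.

Lemma has_sumD a b s t : has_sum a s -> has_sum b t ->
  has_sum (fun i => a i + b i) (s + t).
Proof.
move=> a_s b_t.
rewrite /has_sum (_ : partial_sum _ =
  partial_sum (a : I -> F^o) \+ partial_sum (b : I -> F^o)).
  exact: (cvgD a_s b_t).
by apply/funext => J; rewrite /partial_sum big_split.
Qed.

End unconditional_sums.

Section fusion_frames.
Context {R : realType} {k : scalar_kind} {H : hilbertSpace R k}.
Context {I : countType}.
Local Notation F := (scalars R k).
Implicit Types (D : set H) (K C : {linear H -> H}) (W V : I -> set H).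
Implicit Types (w : I -> F) (A B r : F).

Definition perturbation_terms C (C' : {linear H -> H}) W V w (f : H)
    (i : I) : F :=
  w i ^+ 2 * '[adjoint C' (orth_proj (V i) (C f) - orth_proj (W i) (C f)), f].

Lemma controlled_terms_perturb C (C' : {linear H -> H}) W V w f :
  bounded_operator C' ->
  (forall i, closed_subspace (W i)) -> (forall i, closed_subspace (V i)) ->
  controlled_terms C C' V w f =
  fun i => controlled_terms C C' W w f i + perturbation_terms C C' W V w f i.
Proof.
move=> bC' subW subV; apply/funext => i.
rewrite /controlled_terms /perturbation_terms !hdot_orth_proj//.
by rewrite hdot_adjointl// linearBl -mulrDr addrC subrK.
Qed.

Lemma has_sum_perturbation_terms0 C (C' : {linear H -> H}) W V w :
  has_sum (perturbation_terms C C' W V w 0) 0.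
Proof.
rewrite (_ : perturbation_terms _ _ _ _ _ _ = fun=> 0); first exact: has_sum0.
by apply/funext => i; rewrite /perturbation_terms linear0r mulr0.
Qed.

Lemma controlled_K_fusion_frame_on_perturb D K C (C' : {linear H -> H})
    W V w A B r :
  bounded_operator C' ->
  (forall i, closed_subspace (W i)) -> (forall i, closed_subspace (V i)) ->
  0 <= r -> controlled_K_fusion_frame_on D K C C' W w A B ->
  (forall f, D f -> let t := perturbation_terms C C' W V w f in
    [/\ summable_over t, 0 <= sum_over t & sum_over t <= r * `|f| ^+ 2]) ->
  controlled_K_fusion_frame_on D K C C' V w A (B + r).
Proof.
move=> bC' subW subV r_ge0 [A_gt0 [leAB frameW]] small.
split=> //; split; first by rewrite ler_wpDr.
move=> f Df; have [sumW leA leB] := frameW f Df.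
have [sumt t_ge0 t_le] := small f Df.
have sumV : has_sum (controlled_terms C C' V w f)
    (sum_over (controlled_terms C C' W w f) +
     sum_over (perturbation_terms C C' W V w f)).
  by rewrite (controlled_terms_perturb C w f bC' subW subV); exact: has_sumD.
split; first exact: has_sum_summable_over sumV.
- by rewrite (has_sum_sum_over sumV) ler_wpDr.
- by rewrite (has_sum_sum_over sumV) mulrDl lerD.
Qed.

Lemma controlled_K_fusion_frame_onS D D' K C (C' : {linear H -> H}) W w A B :
  D `<=` D' -> controlled_K_fusion_frame_on D' K C C' W w A B ->
  controlled_K_fusion_frame_on D K C C' W w A B.
Proof. by move=> DD' [? [? frameW]]; do 2!split=> //; move=> f /DD'/frameW. Qed.

Lemma controlled_K_fusion_frame_bessel K C (C' : {linear H -> H}) W w A B :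
  controlled_K_fusion_frame_on setT K C C' W w A B ->
  controlled_bessel_K_fusion C C' W w.
Proof.
move=> [A_gt0 [leAB frameW]]; exists B; split; first exact: lt_le_trans leAB.
by move=> f; have [] := frameW f Logic.I.
Qed.

End fusion_frames.

Theorem proposition4p1 (R : realType) (k : scalar_kind) (H : hilbertSpace R k)
    (I : countType) (K C C' : {linear H -> H}) (W V : I -> set H)
    (w : I -> scalars R k) (A B : scalars R k)
    (sepH : separable_space H)
    (bK : bounded_operator K) (clK : closed (range K))
    (invC : boundedly_invertible C) (invC' : boundedly_invertible C')
    (subW : forall i, closed_subspace (W i)) (w_gt0 : forall i, 0 < w i)
    (frameW : controlled_K_fusion_frame_on setT K C C' W w A B)
    (subV : forall i, closed_subspace (V i))
    (perturb : exists r : scalars R k,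
      [/\ 0 < r, r < A &
        forall f : H, f != 0 ->
          let t := fun i : I => w i ^+ 2 *
            '[adjoint C' (orth_proj (V i) (C f) - orth_proj (W i) (C f)), f] in
          [/\ summable_over t, 0 < sum_over t & sum_over t <= r * `|f| ^+ 2]]) :
  controlled_bessel_K_fusion C C' V w /\
  exists A' B' : scalars R k,
    controlled_K_fusion_frame_on (range K) K C C' V w A' B'.
Proof.
have [bC' _] := invC'; have [r [r_gt0 _ small]] := perturb.
have frameV : controlled_K_fusion_frame_on setT K C C' V w A (B + r).
  apply: controlled_K_fusion_frame_on_perturb bC' subW subV _ frameW _.
    exact: ltW.
  move=> f _ t; have [f0|/small[sum_t t_gt0 t_le]] := eqVneq f 0.
    have sum_t : has_sum t 0.
      by rewrite /t f0; exact: has_sum_perturbation_terms0.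
    rewrite (has_sum_sum_over sum_t) f0 normr0 expr0n mulr0.
    by split=> //; exact: has_sum_summable_over sum_t.
  by split=> //; exact: ltW.
split; first exact: controlled_K_fusion_frame_bessel frameV.
by exists A, (B + r); exact: controlled_K_fusion_frame_onS frameV.
Qed.
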